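(* Let $P_n$ be the path graph of order $n\geq 2$. Then $N_{sp}(P_n)=2$ if $n$ is even and $N_{sp}(P_n)=\frac{3}{2}(n-1)$ if $n$ is odd. Also $N_{sp}(P_1)=1$.
   Context: All graphs are finite, simple, undirected. For $S\subseteq V(G)$, $\overline{S}=V(G)\setminus S$ and $N(v)$ denotes the open neighbourhood of $v$. A set $S$ is a super dominating set of $G$ if every vertex of $\overline{S}$ has a neighbour in $S$ and for every $u\in\overline{S}$ there is $v\in S$ with $N(v)\cap\overline{S}=\{u\}$. The super domination number $\gamma_{sp}(G)$ is the minimum cardinality of a super dominating set of $G$. $N_{sp}(G)$ denotes the number of super dominating sets of $G$ of cardinality $\gamma_{sp}(G)$. $P_n$ is the path on $n$ vertices. *)

(* Defs.v *)
From mathcomp Require Import all_boot.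

Set Implicit Arguments.
Unset Strict Implicit.
Unset Printing Implicit Defensive.

Record sgraph := SGraph {
  vertex : finType;
  adj : rel vertex;
  adj_sym : symmetric adj;
  adj_irr : irreflexive adj }.

Definition neigh (G : sgraph) (v : vertex G) : {set vertex G} :=
  [set u | adj v u].

Definition dominating (G : sgraph) (S : {set vertex G}) : bool :=
  [forall u in ~: S, exists v in S, adj u v].

Definition super_dominating (G : sgraph) (S : {set vertex G}) : bool :=
  dominating S &&
  [forall u in ~: S, exists v in S, neigh v :&: ~: S == [set u]].

Lemma super_dominating_setT (G : sgraph) :
  super_dominating [set: vertex G].
Proof.
by apply/andP; split; apply/forall_inP => u; rewrite setCT in_set0.
Qed.

(* The default value [set: vertex G] is a super dominating set
   (super_dominating_setT), so this is a genuine minimum. *)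
Definition gamma_sp (G : sgraph) : nat :=
  #|[arg min_(S < [set: vertex G] | super_dominating S) #|S|]|.

Definition N_sp (G : sgraph) : nat :=
  #|[set S : {set vertex G} | super_dominating S & #|S| == gamma_sp G]|.

Definition path_adj (n : nat) : rel 'I_n :=
  [rel i j : 'I_n | (i.+1 == j) || (j.+1 == i)].

Lemma path_adj_sym n : symmetric (@path_adj n).
Proof. by move=> i j; apply: orbC. Qed.

Lemma path_adj_irr n : irreflexive (@path_adj n).
Proof. by move=> i; rewrite /path_adj /= orbb gtn_eqF. Qed.

Definition path_graph (n : nat) : sgraph :=
  SGraph (@path_adj_sym n) (@path_adj_irr n).

(* Main.v *)
(* Encode a vertex set of the path by its characteristic word. Super domination
   is then a local condition: each 0 must be adjacent to a 1 whose other
   neighbour is a 1 or missing. Reading the word from left to right, the only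
   relevant information is the last two letters and whether the last 0 is still
   waiting to be followed by 11 or by a final 1. This gives linear recurrences
   for the numbers of accepted words with a prescribed number of 1s, and at the
   minimal number of 1s these recurrences close up. *)
Require Import Defs.
From mathcomp Require Import all_boot all_order all_algebra.
From mathcomp Require Import zify ring.
Import GRing.Theory.

(** * Binary words in which every 0 is guarded *)

Fixpoint words (n : nat) : seq (seq bool) :=
  if n is m.+1 then map (cons true) (words m) ++ map (cons false) (words m)
  else [:: [::]].

Lemma mem_words n s : (s \in words n) = (size s == n).
Proof.
elim: n s => [|n IHn] [|b s] //=; rewrite mem_cat.
  by apply/negP => /orP[] /mapP[].
have cons_inj (c : bool) : injective (cons c) by move=> ? ? [].
rewrite eqSS -IHn; case: b; rewrite mem_map //.
  by rewrite orbC; case: mapP => // -[].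
by case: mapP => // -[].
Qed.

Lemma uniq_words n : uniq (words n).
Proof.
elim: n => //= n IHn; rewrite cat_uniq !map_inj_uniq ?IHn; try by move=> ? ? [].
by rewrite andbT; apply/hasPn => _ /mapP[s _ ->]; apply/mapP => -[].
Qed.

(* [a] and [b] are the two letters preceding [s]; the defaults of [nth] say that
   the letter after the end of the word is not a usable 1, but does not spoil
   the last letter either. A word on its own has to be read after 0 1: the first
   letter is then not guarded from the left, and a 1 there can guard the second. *)
Fixpoint guarded (a b : bool) (s : seq bool) : bool :=
  if s is c :: s' then
    [|| c, a && b | nth false s' 0 && nth true s' 1] && guarded b c s'
  else true.

Definition pending (s : seq bool) : bool :=
  [&& nth false s 0, nth true s 1 & guarded false false s].

Lemma guarded_false_r a s : guarded a false s = guarded true false s.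
Proof. by case: s => //= c s; rewrite andbF. Qed.

(** Without 11 on its left, the new 0 can only be guarded from the right. Past a 0 the letter before
    it has no influence, so all such contexts merge into one state. *)
Lemma guarded_cons0 a b s :
  ~~ (a && b) -> guarded a b (false :: s) = pending s.
Proof.
by move=> /negbTE /= ->; rewrite guarded_false_r -(guarded_false_r false) -andbA.
Qed.

Lemma pending_cons2 a b s :
  pending [:: a, b & s] = [&& a, b & guarded true true s].
Proof. by case: a b => [] []. Qed.

(** Each bound follows from those of the states reached next, so all four go together. The induction
    is strong because a pending 0 consumes two letters. *)
Lemma guarded_size n s : size s <= n ->
  [/\ guarded true true s -> size s <= (count id s).*2.+1,
      guarded false true s -> size s <= (count id s).*2,
      guarded true false s -> size s <= (count id s).*2 &
      pending s -> size s < (count id s).*2].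
Proof.
elim/ltn_ind: n s => n IHn [|c s] lt_sn; first by split.
have [O I Z P] := IHn _ lt_sn s (leqnn _).
split.
- by case: c {lt_sn} => /=; [move=> /O | move=> /Z]; lia.
- by case: c {lt_sn}; [move=> /= /O | rewrite guarded_cons0 //= => /P]; lia.
- by case: c {lt_sn}; [move=> /= /I | rewrite guarded_cons0 //= => /P]; lia.
case: s lt_sn {O I Z P} => [|d s] lt_sn; first by case: c {lt_sn}.
have [O _ _ _] := IHn (size s) (ltnW lt_sn) s (leqnn _).
by rewrite pending_cons2 /= => /and3P[-> -> /O]; lia.
Qed.

(** * Counting guarded words by their number of 1s *)

Definition nb_words (f : pred (seq bool)) (n k : nat) : nat :=
  count (fun s => f s && (count id s == k)) (words n).

Lemma eq_nb_words f g n k : f =1 g -> nb_words f n k = nb_words g n k.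
Proof. by move=> eq_fg; apply: eq_count => s /=; rewrite eq_fg. Qed.

Lemma nb_words_pred0 f n k : f =1 pred0 -> nb_words f n k = 0.
Proof.
by move=> f0; rewrite (eq_nb_words _ _ _ _ f0) /nb_words count_pred0.
Qed.

Lemma nb_wordsS f n k :
  nb_words f n.+1 k.+1 =
  nb_words (f \o cons true) n k + nb_words (f \o cons false) n k.+1.
Proof. by rewrite /nb_words /= count_cat !count_map. Qed.

Lemma nb_words_small (f : pred (seq bool)) n k :
  (forall s, f s -> size s = n -> k < count id s) -> nb_words f n k = 0.
Proof.
move=> lb; apply/eqP; rewrite eqn0Ngt -has_count; apply/hasPn => s.
rewrite mem_words => /eqP sz; apply/negP => /andP[/lb /(_ sz)] /[swap] /eqP->.
by rewrite ltnn.
Qed.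

(* The context before the word: 11 (O), 01 or the start of the path (I), a
   satisfied 0 (Z), a 0 that still needs 11 or a final 1 (P). *)
Notation nbO := (nb_words (guarded true true)).
Notation nbI := (nb_words (guarded false true)).
Notation nbZ := (nb_words (guarded true false)).
Notation nbP := (nb_words pending).

Lemma nbO_S n k : nbO n.+1 k.+1 = nbO n k + nbZ n k.+1.
Proof. by rewrite nb_wordsS. Qed.

Lemma nbI_S n k : nbI n.+1 k.+1 = nbO n k + nbP n k.+1.
Proof.
rewrite nb_wordsS; congr (_ + _).
by apply: eq_nb_words => s; apply: guarded_cons0.
Qed.

Lemma nbZ_S n k : nbZ n.+1 k.+1 = nbI n k + nbP n k.+1.
Proof.
rewrite nb_wordsS; congr (_ + _).
by apply: eq_nb_words => s; apply: guarded_cons0.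
Qed.

Lemma nbP_SS n k : nbP n.+2 k.+2 = nbO n k.
Proof.
rewrite !nb_wordsS -addnA [X in _ + X](_ : _ = 0) ?addn0.
  by apply: eq_nb_words => s; apply: pending_cons2.
by rewrite !nb_words_pred0 // => s; rewrite /= pending_cons2.
Qed.

Lemma nbO_small n k : k.*2.+1 < n -> nbO n k = 0.
Proof.
move=> lt_kn; apply: nb_words_small => s Os sz.
by have [/(_ Os) + _ _ _] := guarded_size _ _ (leqnn (size s)); lia.
Qed.

Lemma nbI_small n k : k.*2 < n -> nbI n k = 0.
Proof.
move=> lt_kn; apply: nb_words_small => s Is sz.
by have [_ /(_ Is) + _ _] := guarded_size _ _ (leqnn (size s)); lia.
Qed.

(** Here the bounds of [guarded_size] are equalities, so only one term of each recurrence
    survives. *)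
Lemma nb_words_odd_states m :
  [/\ nbO m.*2.+1 m = 1, nbZ m.*2 m = 1 & nbP m.*2.+1 m.+1 = 1].
Proof.
elim: m => [|m [IHO IHZ IHP]] //.
(* The new Z comes from the old P, the new O from the new Z, and the new P from the old O. *)
have Zm : nbZ m.+1.*2 m.+1 = 1.
  by rewrite doubleS nbZ_S IHP nbI_small.
split=> //; first by rewrite nbO_S Zm nbO_small.
by rewrite doubleS nbP_SS.
Qed.

Lemma nbI_even m : 0 < m -> nbI m.*2 m = 2.
Proof.
case: m => // m _; have [O _ P] := nb_words_odd_states m.
by rewrite doubleS nbI_S O P.
Qed.

Lemma nbO_even m :
  nbO m.+1.*2 m.+1 = 1 + nbP m.*2 m.+1 + nbI m.*2 m.
Proof.
have [O _ _] := nb_words_odd_states m.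
by rewrite doubleS nbO_S O nbZ_S addnAC addnA.
Qed.

(** By [nbI_S] the count is an O term plus a P term. From [m] to [m.+1] the new P term is the old O
    term, and by [nbO_even] the new O term is the old P term plus 1 + 2; hence the slope 3. *)
Lemma nbI_odd m : 0 < m -> nbI m.*2.+1 m.+1 = 3 * m.
Proof.
case: m => // m _; elim: m => // m; rewrite !nbI_S.
rewrite [nbO m.+2.*2 _]nbO_even nbI_even // (nbP_SS m.+1.*2); lia.
Qed.

(** * From words to vertex sets of the path *)

Lemma guardedP a b s :
  reflect (forall u, u < size s ->
             [|| nth true s u,
                 nth true [:: a, b & s] u && nth true [:: a, b & s] u.+1 |
                 nth false s u.+1 && nth true s u.+2])
          (guarded a b s).
Proof.
elim: s a b => [|c s IHs] a b /=; first by left.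
apply: (iffP andP) => [[c_ok /IHs s_ok] [|u] // /s_ok // | ok].
by split; [apply: (ok 0) | apply/IHs => u; apply: (ok u.+1)].
Qed.

Definition set_word {n} (S : {set 'I_n}) : seq bool :=
  [seq i \in S | i <- enum 'I_n].

Lemma size_set_word n (S : {set 'I_n}) : size (set_word S) = n.
Proof. by rewrite size_map size_enum_ord. Qed.

Lemma nth_set_word n b (S : {set 'I_n}) (i : 'I_n) :
  nth b (set_word S) i = (i \in S).
Proof. by rewrite (nth_map i) ?size_enum_ord // nth_ord_enum. Qed.

Lemma set_word_inj n : injective (@set_word n).
Proof.
move=> S T eqST; apply/setP => i.
by rewrite -(nth_set_word _ true) eqST nth_set_word.
Qed.

Lemma count_set_word n (S : {set 'I_n}) : count id (set_word S) = #|S|.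
Proof. by rewrite count_map cardE size_filter enumT; apply: eq_count. Qed.

Lemma perm_set_words n :
  perm_eq [seq set_word A | A <- enum {: {set 'I_n}}] (words n).
Proof.
apply: uniq_perm; rewrite ?uniq_words //.
  by rewrite map_inj_uniq ?enum_uniq //; apply: set_word_inj.
move=> s; rewrite mem_words; apply/mapP/eqP => [[S _ ->]|sz].
  exact: size_set_word.
exists [set i : 'I_n | nth true s i]; first by rewrite mem_enum.
apply: (@eq_from_nth _ true) => [|i]; first by rewrite size_set_word.
by rewrite sz => lt_in; rewrite (nth_set_word _ _ _ (Ordinal lt_in)) inE.
Qed.

Lemma card_set_words n (f : pred (seq bool)) k :
  #|[set A : {set 'I_n} | f (set_word A) && (#|A| == k)]| = nb_words f n k.
Proof.
rewrite /nb_words -(permP (perm_set_words n)) count_map cardE size_filter enumT.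
by apply: eq_count => S /=; rewrite inE count_set_word.
Qed.

Lemma path_adjE n (u v : 'I_n) : path_adj u v = (u.+1 == v) || (v.+1 == u).
Proof. by []. Qed.

(** The disjuncts are the two candidates [v] = [u] - 1 and [v] = [u] + 1, whose other neighbour must
    be in [S] or missing. The two letters put in front shift positions by two. *)
Lemma path_private_neighbourP n (S : {set 'I_n}) (u : 'I_n) : u \notin S ->
  reflect (exists2 v : vertex (path_graph n),
              v \in S & neigh v :&: ~: S == [set u])
    (let s := set_word S in
     nth true [:: false, true & s] u && nth true [:: false, true & s] u.+1 ||
     nth false s u.+1 && nth true s u.+2).
Proof.
move=> uS; rewrite /=.
have nthS b (i : nat) (lt_in : i < n) :
  nth b (set_word S) i = (Ordinal lt_in \in S).
  by rewrite -(nth_set_word _ b _ (Ordinal lt_in)).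
have nthD b (i : nat) : n <= i -> nth b (set_word S) i = b.
  by move=> le_ni; rewrite nth_default ?size_set_word.
apply: (iffP orP) => [[]|[v vS /eqP/setP Nv]].
- case: u uS => -[|u] //= lt_un uS; have lt_un' := ltnW lt_un.
  rewrite nthS => /andP[pre vS]; exists (Ordinal lt_un') => //.
  apply/eqP/setP => w; rewrite !inE /= path_adjE /=.
  apply/andP/eqP => [[/orP[/eqP uw|/eqP wu] wS]|->].
  + exact: val_inj.
  + subst u; case/negP: wS; move: pre => /=.
    by rewrite nth_set_word.
  by rewrite /= eqxx uS.
- case/andP=> + post; have [lt_un|/nthD->//] := ltnP u.+1 n.
  rewrite nthS => vS; exists (Ordinal lt_un) => //.
  apply/eqP/setP => w; rewrite !inE /= path_adjE /=.
  apply/andP/eqP => [[/orP[/eqP uw|/eqP [wu]] wS]|->].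
  + by case/negP: wS; move: post; rewrite uw nth_set_word.
  + exact: val_inj.
  by rewrite /= eqxx orbT uS.
have := Nv u; rewrite !inE eqxx uS andbT /= path_adjE => /orP[] /eqP uv.
  left; rewrite -uv /= nth_set_word vS andbT.
  (* If the left neighbour [k] of [v] were outside [S], it would have to equal [u], which is [k] +
     2. *)
  case def_v: (nat_of_ord v) => [|k] //=.
  have lt_kn : k < n by have := ltn_ord v; lia.
  rewrite nthS; apply/negPn/negP => kS; have := Nv (Ordinal lt_kn).
  rewrite !inE kS andbT /= path_adjE /= def_v eqxx orbT => /esym/eqP/(congr1 val).
  by rewrite /= -uv def_v; lia.
right; rewrite uv nth_set_word vS.
have [lt_vn|/nthD->//] := ltnP v.+1 n.
rewrite nthS; apply/negPn/negP => kS; have := Nv (Ordinal lt_vn).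
rewrite !inE kS andbT /= path_adjE /= eqxx => /esym/eqP/(congr1 val) /=.
by rewrite -uv; lia.
Qed.

(** A vertex [v] of [S] whose only neighbour outside [S] is [u] is adjacent to [u], hence dominates
    it. *)
Lemma super_dominatingE (G : sgraph) (S : {set vertex G}) :
  super_dominating S =
  [forall u in ~: S, exists v in S, neigh v :&: ~: S == [set u]].
Proof.
rewrite /super_dominating; apply: andb_idl => /forall_inP sd.
apply/forall_inP => u /sd /exists_inP[v vS /eqP/setP /(_ u)].
rewrite !inE eqxx => /andP[uv _]; apply/exists_inP; exists v => //.
by rewrite adj_sym.
Qed.

Lemma super_dominating_path n (S : {set 'I_n}) :
  @super_dominating (path_graph n) S = guarded false true (set_word S).
Proof.
rewrite super_dominatingE; apply/forall_inP/guardedP => [sd u|ok u].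
  rewrite size_set_word => lt_un.
  have -> : u = Ordinal lt_un by [].
  rewrite nth_set_word; have [//|uS] := boolP (Ordinal lt_un \in S).
  apply/path_private_neighbourP => //; apply/exists_inP/sd.
  by rewrite inE.
rewrite inE => uS; apply/exists_inP/path_private_neighbourP => //.
by have := ok u; rewrite size_set_word nth_set_word (negbTE uS); apply.
Qed.

Lemma card_super_dominating_path n k :
  #|[set A : {set vertex (path_graph n)} | super_dominating A & #|A| == k]|
  = nbI n k.
Proof.
rewrite -card_set_words; apply: eq_card => S.
by rewrite !inE super_dominating_path.
Qed.

(** The hypotheses force [gamma_sp] to be [k]: some set of size [k] is counted, and a smaller
    minimiser would make an earlier count nonzero. *)
Lemma N_sp_path n k :
  0 < nbI n k -> (forall j, j < k -> nbI n j = 0) ->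
  N_sp (path_graph n) = nbI n k.
Proof.
move=> nb_gt0 nb_small; rewrite -card_super_dominating_path /N_sp.
suff -> : gamma_sp (path_graph n) = k by [].
rewrite /gamma_sp; case: arg_minnP => [|S sdS minS].
  exact: super_dominating_setT.
move: nb_gt0; rewrite -card_super_dominating_path card_gt0.
case/set0Pn=> T; rewrite inE => /andP[/minS le_ST /eqP cardT].
apply/eqP; rewrite eqn_leq -{1}cardT le_ST leqNgt.
apply/negP => /nb_small/eqP; rewrite -card_super_dominating_path cards_eq0.
by move/eqP/setP/(_ S); rewrite !inE sdS eqxx.
Qed.

Lemma N_sp_path_even m : 0 < m -> N_sp (path_graph m.*2) = 2.
Proof.
move=> m_gt0; rewrite (N_sp_path _ m) ?nbI_even // => j lt_jm.
by rewrite nbI_small // ltn_double.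
Qed.

Lemma N_sp_path_odd m : 0 < m -> N_sp (path_graph m.*2.+1) = 3 * m.
Proof.
move=> m_gt0; rewrite (N_sp_path _ m.+1) ?nbI_odd ?muln_gt0 // => j lt_jm.
by rewrite nbI_small // ltnS leq_double.
Qed.

Local Open Scope ring_scope.

Theorem theorem6p3 :
  (forall n : nat, (2 <= n)%N ->
     (~~ odd n -> N_sp (path_graph n) = 2%N) /\
     (odd n -> (N_sp (path_graph n))%:R = 3 / 2 * (n%:R - 1) :> rat)) /\
  N_sp (path_graph 1) = 1%N.
Proof.
(* For one vertex the counts are evaluated directly: the word 1 is accepted and the word 0 is
   not. *)
split=> [n n_ge2|]; last by rewrite (N_sp_path _ 1) // => -[].
rewrite -(odd_double_half n) in n_ge2 *; move: n_ge2.
set m := n./2; case: (odd n) => m_gt; rewrite oddD odd_double /=; split=> // _.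
  rewrite N_sp_path_odd; last by case: m m_gt.
  by rewrite natrM natrD -muln2 natrM; field.
by rewrite N_sp_path_even //; case: m m_gt.
Qed.
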